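(* Let $\big\Vert \mathbf{z}-\sum_{j=1}^{r_z}\bigotimes_{\mu=1}^d\mathbf{z}_{j\mu}\big\Vert\le\varepsilon$. Assume that there is an iterative method that can be used to solve the linear system $\mathbf{C}\mathbf{w}=\mathbf{z}$ in a low-rank tensor format and to find the solution in the form $\mathbf{w}=\sum_{i=1}^{r}\bigotimes_{\mu=1}^d\mathbf{w}_{i\mu}$. Then the quadratic form $\mathbf{z}^T\mathbf{C}^{-1}\mathbf{z}$ is given by the following scalar products: $$\mathbf{z}^T\mathbf{C}^{-1}\mathbf{z}=\sum_{i=1}^{r}\sum_{j=1}^{r_z}\prod_{\mu=1}^d\left(\mathbf{w}_{i\mu},\mathbf{z}_{j\mu}\right).$$
   Context: $\mathbf{C}$ is a symmetric positive definite (covariance) matrix and $\mathbf{z}$ a vector of matching size, both living on a $d$-dimensional tensor grid. $\bigotimes$ denotes the Kronecker (tensor) product of vectors; for each direction $\mu$ the vectors $\mathbf{w}_{i\mu}$ and $\mathbf{z}_{j\mu}$ have the same length (the number of grid points in direction $\mu$), and $(\cdot,\cdot)$ is their Euclidean scalar product. $r_z$ and $r$ are the numbers of terms in the separable representations of $\mathbf{z}$ and $\mathbf{w}$.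
   Formalization: The equality fails for ε > 0 (d = 1, C = z = w = 1, z₁₁ = 0, ε = 1), so it is stated for ε = 0; for any ε it is exact with the separable approximation of z as right argument of the form, and holds for z up to error ε‖w‖. *)

(* Defs.v *)
From HB Require Import structures.
From mathcomp Require Import all_boot all_order all_algebra.

Set Implicit Arguments.
Unset Strict Implicit.
Unset Printing Implicit Defensive.

Import Order.TTheory GRing.Theory Num.Theory.
Local Open Scope ring_scope.

(* The d-dimensional tensor grid with n mu points in direction mu; a point is
   a multi-index (i_1, ..., i_d).  A grid function is a vector 'cV_#|grid n|,
   whose entries are numbered by [enum_val]/[enum_rank]; its size is the
   product of the n mu. *)
Definition grid (d : nat) (n : 'I_d -> nat) : finType :=
  {dffun forall mu : 'I_d, 'I_(n mu)}.

(* The Kronecker product of one vector per direction: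
   its entry at (i_1, ..., i_d) is the product of the v_mu(i_mu). *)
Definition kron (R : comNzRingType) (d : nat) (n : 'I_d -> nat)
    (v : forall mu : 'I_d, 'cV[R]_(n mu)) : 'cV[R]_#|grid n| :=
  \col_k \prod_(mu < d) v mu ((enum_val k : grid n) mu) 0.

Definition dot (R : comNzRingType) (m : nat) (u v : 'cV[R]_m) : R :=
  \sum_(k < m) u k 0 * v k 0.

Definition enorm (R : rcfType) (m : nat) (v : 'cV[R]_m) : R :=
  Num.sqrt (dot v v).

Definition sym_posdef (R : numDomainType) (m : nat) (A : 'M[R]_m) : Prop :=
  A^T = A /\ forall x : 'cV[R]_m, x != 0 -> 0 < (x^T *m A *m x) 0 0.

(* Main.v *)
Require Import Defs.
From HB Require Import structures.
From mathcomp Require Import all_boot all_order all_algebra.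
From mathcomp Require Import ring.

Set Implicit Arguments.
Unset Strict Implicit.
Unset Printing Implicit Defensive.

Import Order.TTheory GRing.Theory Num.Theory.
Local Open Scope ring_scope.

(** Since C is symmetric and z = C w, the row vector z^T C^-1 is just w^T: the
    quadratic form with z on the left is the scalar product with w
    ([quad_solve]), so that no inverse is left to compute.  Scalar products of
    Kronecker products factor over the directions ([dot_kron]): the sum over
    all grid points of a product over the directions is, by distributivity,
    the product of the sums over each direction.  Expanding w and the separable
    sum zs bilinearly therefore turns (w, zs) into the double sum of products.

    The form itself is (w, z), hence it differs from the double sum by
    (w, z - zs), which Cauchy-Schwarz bounds by eps times the norm of w.  For
    eps = 0 this bound forces equality. *)

Lemma dotE (R : comNzRingType) (m : nat) (u v : 'cV[R]_m) :
  dot u v = (u^T *m v) 0 0.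
Proof. by rewrite mxE; apply: eq_bigr => k _; rewrite mxE. Qed.

Lemma dotC (R : comNzRingType) (m : nat) (u v : 'cV[R]_m) : dot u v = dot v u.
Proof. by apply: eq_bigr => k _; rewrite mulrC. Qed.

Lemma dotBr (R : comNzRingType) (m : nat) (u v v' : 'cV[R]_m) :
  dot u (v - v') = dot u v - dot u v'.
Proof. by rewrite !dotE mulmxBr !mxE. Qed.

Lemma dotZr (R : comNzRingType) (m : nat) (a : R) (u v : 'cV[R]_m) :
  dot u (a *: v) = a * dot u v.
Proof. by rewrite !dotE -scalemxAr mxE. Qed.

Lemma dot_sumr (R : comNzRingType) (m : nat) (I : finType) (u : 'cV[R]_m)
    (v : I -> 'cV[R]_m) : dot u (\sum_i v i) = \sum_i dot u (v i).
Proof.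
by rewrite dotE mulmx_sumr summxE; apply: eq_bigr => i _; rewrite dotE.
Qed.

Lemma dot_ge0 (R : realDomainType) (m : nat) (v : 'cV[R]_m) : 0 <= dot v v.
Proof. by apply: sumr_ge0 => k _; rewrite -expr2 sqr_ge0. Qed.

Lemma dot_eq0 (R : realDomainType) (m : nat) (v : 'cV[R]_m) :
  dot v v = 0 -> v = 0.
Proof.
move/eqP; rewrite psumr_eq0 => [/allP v0|k _]; last by rewrite -expr2 sqr_ge0.
apply/colP => k; rewrite mxE; apply/eqP.
by have := v0 k (mem_index_enum k); rewrite mulf_eq0 orbb.
Qed.

(** For v nonzero, put a = (u, u), b = (v, v), c = (u, v): the vector b u - c v,
    which is b times the component of u orthogonal to v, has squared norm
    b (a b - c^2), and b > 0 can be cancelled.  Working with b u - c v rather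
    than u - (c / b) v avoids division. *)
Lemma sqr_dot_le (R : realDomainType) (m : nat) (u v : 'cV[R]_m) :
  dot u v ^+ 2 <= dot u u * dot v v.
Proof.
have [v0|v_neq0] := eqVneq (dot v v) 0.
  by rewrite (dot_eq0 v0) -(scale0r 0) !dotZr !mul0r mulr0 expr0n.
have v_gt0 : 0 < dot v v by rewrite lt_def v_neq0 dot_ge0.
have := dot_ge0 (dot v v *: u - dot u v *: v).
have -> : dot (dot v v *: u - dot u v *: v) (dot v v *: u - dot u v *: v)
          = dot v v * (dot u u * dot v v - dot u v ^+ 2).
  rewrite dotBr !dotZr ![dot (_ - _) _]dotC !dotBr !dotZr (dotC v u).
  ring.
by rewrite pmulr_rge0 // subr_ge0.
Qed.

Lemma cauchy_schwarz (R : rcfType) (m : nat) (u v : 'cV[R]_m) :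
  `|dot u v| <= enorm u * enorm v.
Proof.
rewrite /enorm -sqrtrM ?dot_ge0 // -sqrtr_sqr.
by apply: ler_wsqrtr; apply: sqr_dot_le.
Qed.

(** Distributivity of product over sum, when the range of the i-th sum is a type
    that depends on i.  Distributivity for a single range type applies after
    encoding the values in the total space {i : I & T i}: a dependent function
    becomes an ordinary one whose value at i carries the tag i. *)
Lemma sum_dffun_prod (R : comNzRingType) (I : finType) (T : I -> finType)
    (F : forall i, T i -> R) :
  \sum_(x : {dffun forall i, T i}) \prod_i F i (x i)
  = \prod_i \sum_(t : T i) F i t.
Proof.
rewrite (reindex (@dffun_of_fprod I T)) /=; last first.
  exact/onW_bij/dffun_of_fprod_bij.
pose P i := [ffun t => F i t].
transitivity (\sum_(f : fprod T) \prod_(i in I) P i (f i)).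
  by apply: eq_bigr => f _; apply: eq_bigr => i _; rewrite !ffunE.
(* Both sides become sums over tagged values; [untag 0] is the extension of
   P i by zero to values whose tag is not i. *)
rewrite (big_fprod 1 _ P) -(bigA_distr_big_dep _ (fun i u => untag 0 (P i) u)).
apply: eq_bigr => i _; rewrite -(big_tag (fun i => P i)).
by apply: eq_bigr => t _; rewrite ffunE.
Qed.

Lemma dot_kron (R : comNzRingType) (d : nat) (n : 'I_d -> nat)
    (u v : forall mu, 'cV[R]_(n mu)) :
  dot (kron u) (kron v) = \prod_(mu < d) dot (u mu) (v mu).
Proof.
(* The entries of [kron] are numbered by [enum_val], so the sum over grid points
   is read through that numbering. *)
rewrite -sum_dffun_prod [RHS](big_enum_val (A := grid n)) /=.
by apply: eq_bigr => k _; rewrite !mxE -big_split.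
Qed.

(** A nonzero v with v A = 0 would make the quadratic form vanish at v^T. *)
Lemma posdef_unitmx (R : realFieldType) (m : nat) (A : 'M[R]_m) :
  sym_posdef A -> A \in unitmx.
Proof.
move=> [_ posA]; rewrite unitmxE unitfE; apply/det0P => -[v v_neq0 vA0].
have := posA v^T; rewrite trmxK vA0 mul0mx mxE ltxx trmx_eq0.
by move/(_ v_neq0).
Qed.

(** Symmetry gives (A w)^T = w^T A, and this A cancels against the inverse. *)
Lemma quad_solve (R : realFieldType) (m : nat) (A : 'M[R]_m) (w x : 'cV[R]_m) :
  sym_posdef A -> ((A *m w)^T *m invmx A *m x) 0 0 = dot w x.
Proof.
move=> posA; rewrite trmx_mul (proj1 posA) mulmxK ?dotE //.
exact: posdef_unitmx.
Qed.

(* For eps > 0 the equality between the quadratic form of z and the sum of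
   scalar products cannot be exact: with d = 1, C = 1, z = w = 1, zero
   separable approximation and eps = 1 the two sides are 1 and 0.  The
   conclusion gives the exact equality when the separable representation of z
   is exact (eps = 0), and for arbitrary eps the exact equality with the
   separable representation as one of the two arguments of the form, and the
   equality up to the induced error eps * |w|. *)
Theorem lemma4p4 (R : rcfType) (d : nat) (n : 'I_d -> nat)
    (C : 'M[R]_#|grid n|) (z w : 'cV[R]_#|grid n|) (eps : R) (r rz : nat)
    (wf : 'I_r -> forall mu : 'I_d, 'cV[R]_(n mu))
    (zf : 'I_rz -> forall mu : 'I_d, 'cV[R]_(n mu))
    (hC : sym_posdef C)
    (hz : enorm (z - \sum_(j < rz) kron (zf j)) <= eps)
    (hCw : C *m w = z)
    (hw : w = \sum_(i < r) kron (wf i)) :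
  [/\ eps = 0 ->
        (z^T *m invmx C *m z) 0 0
        = \sum_(i < r) \sum_(j < rz) \prod_(mu < d) dot (wf i mu) (zf j mu),
      (z^T *m invmx C *m (\sum_(j < rz) kron (zf j))) 0 0
      = \sum_(i < r) \sum_(j < rz) \prod_(mu < d) dot (wf i mu) (zf j mu)
    & `|(z^T *m invmx C *m z) 0 0
        - \sum_(i < r) \sum_(j < rz) \prod_(mu < d) dot (wf i mu) (zf j mu)|
      <= eps * enorm w].
Proof.
have formE x : (z^T *m invmx C *m x) 0 0 = dot w x by rewrite -hCw quad_solve.
pose zs := \sum_(j < rz) kron (zf j).
have sepE : \sum_(i < r) \sum_(j < rz) \prod_(mu < d) dot (wf i mu) (zf j mu)
            = dot w zs.
  rewrite dotC hw dot_sumr; apply: eq_bigr => i _.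
  rewrite dotC dot_sumr; apply: eq_bigr => j _.
  by rewrite dot_kron.
have error_le : `|dot w z - dot w zs| <= eps * enorm w.
  rewrite -dotBr dotC (le_trans (cauchy_schwarz _ _)) //.
  by rewrite ler_wpM2r ?sqrtr_ge0.
rewrite !formE sepE; split=> // eps0.
by apply/eqP; rewrite -subr_eq0 -normr_le0 (le_trans error_le) // eps0 mul0r.
Qed.
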